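(* Let $R$ be a ring and $M$ a right $R$-module. The following conditions are equivalent: (a) $M$ is abelian endoregular. (b) $M$ is endoregular and every $M$-generated submodule of $M$ is fully invariant in $M$.
   Context: Rings are associative with identity and modules are unitary right modules. A ring $S$ is von Neumann regular if for every $s\in S$ there is $x\in S$ with $sxs=s$; it is abelian if every idempotent of $S$ is central. A module $M$ is endoregular if $\operatorname{End}_R(M)$ is von Neumann regular, and abelian endoregular if $\operatorname{End}_R(M)$ is abelian von Neumann regular. A module $N$ is $M$-generated if there is an epimorphism $M^{(\mathcal I)}\to N$ for some index set $\mathcal I$. A submodule $N$ of $M$ is fully invariant if $\varphi(N)\subseteq N$ for all $\varphi\in\operatorname{End}_R(M)$. *)

(* Defs.v *)
From HB Require Import structures.
From mathcomp Require Import all_boot all_algebra.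
From mathcomp Require Import boolp classical_sets functions cardinality.

Set Implicit Arguments.
Unset Strict Implicit.
Unset Printing Implicit Defensive.

Import GRing.Theory.
Local Open Scope ring_scope.

(* A right R-module is a left module over the converse ring R^c; rings and    *)
(* endomorphism rings may be zero, hence pzRingType throughout.               *)
Notation rmodType R := (lmodType R^c).

Definition vonNeumann_regular (S : pzRingType) : Prop :=
  forall s : S, exists x : S, s * x * s = s.

Definition abelian_ring (S : pzRingType) : Prop :=
  forall e : S, e * e = e -> forall s : S, e * s = s * e.

(* The endomorphism ring: pointwise addition, composition as product.         *)
Section Endomorphisms.
Context (R : pzRingType) (M : lmodType R).

Definition endo := {linear M -> M}.

Implicit Types f g h : endo.

HB.instance Definition _ := gen_eqMixin endo.
HB.instance Definition _ := gen_choiceMixin endo.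

Lemma endoP f g : (f : M -> M) =1 g -> f = g.
Proof.
move=> /funext; case: f g => [f [[fD] [fZ]]] [g [[gD] [gZ]]] /= fg.
case: g / fg gD gZ => gD gZ.
by rewrite (Prop_irrelevance gD fD) (Prop_irrelevance gZ fZ).
Qed.

Definition endo_zero : endo := \0.
Definition endo_opp f : endo := \- f.
Definition endo_add f g : endo := f \+ g.
Definition endo_one : endo := idfun.
Definition endo_comp f g : endo := f \o g.

Fact endo_addA : associative endo_add.
Proof. by move=> f g h; apply: endoP => x /=; rewrite addrA. Qed.
Fact endo_addC : commutative endo_add.
Proof. by move=> f g; apply: endoP => x /=; rewrite addrC. Qed.
Fact endo_add0 : left_id endo_zero endo_add.
Proof. by move=> f; apply: endoP => x /=; rewrite add0r. Qed.
Fact endo_addN : left_inverse endo_zero endo_opp endo_add.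
Proof. by move=> f; apply: endoP => x /=; rewrite addNr. Qed.

HB.instance Definition _ :=
  GRing.isZmodule.Build endo endo_addA endo_addC endo_add0 endo_addN.

Fact endo_compA : associative endo_comp.
Proof. by move=> f g h; apply: endoP. Qed.
Fact endo_1comp : left_id endo_one endo_comp.
Proof. by move=> f; apply: endoP. Qed.
Fact endo_comp1 : right_id endo_one endo_comp.
Proof. by move=> f; apply: endoP. Qed.
Fact endo_compDl : left_distributive endo_comp +%R.
Proof. by move=> f g h; apply: endoP. Qed.
Fact endo_compDr : right_distributive endo_comp +%R.
Proof. by move=> f g h; apply: endoP => x /=; rewrite raddfD. Qed.

HB.instance Definition _ :=
  GRing.Zmodule_isPzRing.Build endo
    endo_compA endo_1comp endo_comp1 endo_compDl endo_compDr.

Definition endoregular : Prop := vonNeumann_regular endo.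

Definition abelian_endoregular : Prop :=
  abelian_ring endo /\ vonNeumann_regular endo.

End Endomorphisms.

(* The direct sum M^(I), as the finitely supported families in I -> M.        *)
Section DirectSum.
Context (R : pzRingType) (I : Type) (M : lmodType R).

Definition fin_supp : {pred I -> M} :=
  fun f => `[< finite_set [set i | f i != 0] >].

Fact fin_supp_submod_closed : submod_closed fin_supp.
Proof.
split=> [|a f g /asboolP ff /asboolP fg].
  apply/asboolP; apply: (sub_finite_set _ (finite_set0 I)) => i /=.
  by rewrite eqxx.
apply/asboolP; apply: (@sub_finite_set _ _
    ([set i | f i != 0] `|` [set i | g i != 0])%classic); last first.
  by rewrite finite_setU.
move=> i /=; have [fi0|fi0 _] := eqVneq (f i) 0; last by left.
have [gi0|gi0 _] := eqVneq (g i) 0; last by right.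
have -> : (a *: f + g) i = a *: f i + g i by [].
by rewrite fi0 gi0 scaler0 addr0 eqxx.
Qed.

HB.instance Definition _ :=
  GRing.isSubmodClosed.Build R (I -> M) fin_supp fin_supp_submod_closed.

Record dsum := DSum { dsum_val :> I -> M; _ : dsum_val \in fin_supp }.

HB.instance Definition _ := [isSub for dsum_val].
HB.instance Definition _ := [Choice of dsum by <:].
HB.instance Definition _ := [SubChoice_isSubLmodule of dsum by <:].

End DirectSum.

(* N as an R-module in its own right, with the operations of M. Membership is *)
(* boolean, but since `[< P >] decides any P this covers all submodules.      *)
Section Submodule.
Context (R : pzRingType) (M : lmodType R) (N : submodClosed M).

Record submod := Submod { submod_val : M; _ : submod_val \in N }.

HB.instance Definition _ := [isSub for submod_val].
HB.instance Definition _ := [Choice of submod by <:].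
HB.instance Definition _ := [SubChoice_isSubLmodule of submod by <:].

Definition fully_invariant : Prop :=
  forall (phi : endo M) (x : M), x \in N -> phi x \in N.

End Submodule.

(* Epimorphisms of modules are the surjective homomorphisms.                  *)
Definition generated (R : pzRingType) (M N : lmodType R) : Prop :=
  exists (I : Type) (f : {linear dsum I M -> N}),
    forall y : N, exists x : dsum I M, f x = y.

(* Main.v *)
(** If [f : M^(I) -> N] is onto and [g_i : M -> N] are its components, regularity
    gives [g_i = g_i y g_i], where the idempotent [e = g_i y] is central; hence
    [phi g_i = phi e g_i = e phi g_i = g_i (y phi g_i)] maps into [N], for every
    endomorphism [phi].  Conversely, [e M] is [M]-generated for every idempotent
    [e]; full invariance of [e M] and of [(1 - e) M] says [e s e = s e] and
    [e s (1 - e) = 0], that is [e s = s e]. *)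
From HB Require Import structures.
Require Import Defs.
From mathcomp Require Import all_boot all_algebra.
From mathcomp Require Import boolp classical_sets functions cardinality.

Set Implicit Arguments.
Unset Strict Implicit.
Unset Printing Implicit Defensive.

Import GRing.Theory.
Local Open Scope ring_scope.

Section RingLemmas.
Context (S : pzRingType).
Implicit Types e s x : S.

(** In ideal terms, $Ss \subseteq sS$: principal right ideals are two-sided. *)
Lemma abelian_regular_mul_factor s t :
  abelian_ring S -> vonNeumann_regular S -> exists x, t * s = s * x.
Proof.
move=> abS /(_ s) [y sys]; exists (y * t * s).
have e_idem : s * y * (s * y) = s * y by rewrite mulrA sys.
by rewrite -{1}sys mulrA -(abS _ e_idem) !mulrA.
Qed.

Lemma idempotent_compl e : e * e = e -> (1 - e) * (1 - e) = 1 - e.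
Proof. by move=> ee; rewrite mulrBl mul1r mulrBr mulr1 ee subrr subr0. Qed.

Lemma abelian_ring_corner :
  (forall e, e * e = e -> forall s, e * (s * e) = s * e) -> abelian_ring S.
Proof.
move=> corner e ee s; rewrite -[RHS]corner //.
(* The complement [1 - e] yields [e * (s * (1 - e)) = 0]. *)
have /eqP := corner _ (idempotent_compl ee) s.
rewrite mulrBl mul1r -subr_eq0 addrC addrA addNr add0r oppr_eq0.
by rewrite !mulrBr mulr1 subr_eq0 => /eqP.
Qed.

End RingLemmas.

Section DirectSumInjection.
Context (R : pzRingType) (I : Type) (M : lmodType R).

Definition single_fun (i : I) (m : M) : I -> M :=
  fun j => if `[< j = i >] then m else 0.

Fact single_fun_fin_supp i m : single_fun i m \in @fin_supp R I M.
Proof.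
apply/asboolP; apply: (sub_finite_set _ (finite_set1 i)) => j /=.
by rewrite /single_fun; case: asboolP => // _; rewrite eqxx.
Qed.

Definition single i m : dsum I M := DSum (single_fun_fin_supp i m).

Fact single_linear i : linear (single i).
Proof.
move=> a m n; apply: val_inj; apply/funext => j.
have -> : val (a *: single i m + single i n) j
        = a *: single_fun i m j + single_fun i n j by [].
by rewrite /= /single_fun; case: asboolP; rewrite // scaler0 addr0.
Qed.

HB.instance Definition _ i :=
  GRing.isLinear.Build R M (dsum I M) _ (single i) (single_linear i).

(** Peeling off one coordinate at a time exhausts a finite support; this reduces claims about a map
    on $M^{(I)}$ to its components. *)
Lemma dsum_ind (P : dsum I M -> Prop) :
  P 0 -> (forall u v, P u -> P v -> P (u + v)) ->
  (forall i m, P (single i m)) -> forall u, P u.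
Proof.
move=> P0 PD P1 u.
(* [{classic I}] equips the bare type [I] with the equality test that lists need. *)
have /asboolP/(@finite_seqP {classic I}) [s us] : dsum_val u \in @fin_supp R I M
  by exact: valP.
(* Only an inclusion of the support in [s] is kept, as this passes to the tail of [s]. *)
have {us} : forall i : {classic I}, u i != 0 -> i \in s.
  by move=> i ui; have : [set` s]%classic i by rewrite -us.
elim: s u => [|a s IHs] u us.
  suff -> : u = 0 by [].
  apply: val_inj; apply/funext => i; apply/eqP; apply/negP => /negP.
  by move/us.
rewrite -(subrK (single a (u a)) u); apply: (PD) => //; apply: IHs => i.
have -> : (u - single a (u a)) i = u i - single_fun a (u a) i by [].
rewrite /single_fun; case: asboolP => [->|ia]; first by rewrite subrr eqxx.
by rewrite subr0 => /us; rewrite inE => /orP[/eqP|].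
Qed.

End DirectSumInjection.

Section EndomorphismImage.
Context (R : pzRingType) (M : lmodType R) (e : endo M).

Definition endo_im : {pred M} := fun x => `[< exists y, e y = x >].

Fact endo_im_submod_closed : submod_closed endo_im.
Proof.
split=> [|a x y /asboolP[x' <-] /asboolP[y' <-]]; apply/asboolP.
  by exists 0; rewrite linear0.
by exists (a *: x' + y'); rewrite linearP.
Qed.

HB.instance Definition _ :=
  GRing.isSubmodClosed.Build R M endo_im endo_im_submod_closed.

Fact endo_im_mem (x : M) : e x \in endo_im.
Proof. by apply/asboolP; exists x. Qed.

(** $M^{(I)}$ with [I = unit] is a copy of $M$, so one summand already covers the image. *)
Definition endo_corestr (u : dsum unit M) : submod endo_im :=
  Submod (endo_im_mem (u tt)).

Fact endo_corestr_linear : linear endo_corestr.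
Proof. by move=> a u v; apply: val_inj; rewrite /= linearP. Qed.

HB.instance Definition _ :=
  GRing.isLinear.Build R (dsum unit M) (submod endo_im) _
    endo_corestr endo_corestr_linear.

Lemma generated_endo_im : generated M (submod endo_im).
Proof.
exists unit, endo_corestr => -[y ye]; have /asboolP[x xy] := ye.
exists (single tt x); apply: val_inj => /=.
by rewrite /single_fun asboolT.
Qed.

Lemma idempotent_endo_im x : e * e = e -> x \in endo_im -> e x = x.
Proof. by move=> ee /asboolP[y <-]; rewrite -[in RHS]ee. Qed.

End EndomorphismImage.

(** Left modules over any ring are treated; right modules are the case [R^c]. *)
Lemma abelian_endoregular_fully_invariant (R : pzRingType) (M : lmodType R)
    (N : submodClosed M) :
  abelian_endoregular M -> generated M (submod N) -> fully_invariant N.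
Proof.
move=> [abM regM] [I [f f_surj]] phi x xN.
have [u fu] := f_surj (Submod xN).
(* The claim is now additive in [u], so a single summand suffices. *)
have -> : x = val (f u) by rewrite fu.
elim/dsum_ind: u {fu} => [|u v Nu Nv|i m].
- by rewrite !linear0 rpred0.
- by rewrite !linearD rpredD.
pose g : endo M := val \o (f \o single i).
have [y phig] := abelian_regular_mul_factor g phi abM regM.
have -> : phi (val (f (single i m))) = (phi * g) m by [].
(* [g * y] still factors through the inclusion of [N]. *)
by rewrite phig; exact: valP.
Qed.

Lemma fully_invariant_abelian_ring (R : pzRingType) (M : lmodType R) :
  (forall N : submodClosed M, generated M (submod N) -> fully_invariant N) ->
  abelian_ring (endo M).
Proof.
move=> fiM; apply: abelian_ring_corner => e ee s; apply: endoP => x.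
(* [e] fixes [s (e x)] because [s] preserves the image of [e]. *)
apply: (@idempotent_endo_im _ _ e (s (e x))) => //.
exact: (fiM _ (generated_endo_im e)) (endo_im_mem e x).
Qed.

Theorem proposition2p9 (R : pzRingType) (M : rmodType R) :
  abelian_endoregular M <->
  (endoregular M /\
   forall N : submodClosed M, generated M (submod N) -> fully_invariant N).
Proof.
split=> [abM|[regM fiM]].
  split; first exact: abM.2.
  by move=> N; exact: abelian_endoregular_fully_invariant.
by split=> //; exact: fully_invariant_abelian_ring.
Qed.
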